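(* Let $G$ be a group of exponent greater than $2$ (equivalently, $G$ contains an element $g$ with $g^2\neq 1$), let $T:=\{z\in Z(G)\mid z^2=1\}$, and let $\mathcal{O}:=G/\operatorname{Inn}(\operatorname{Core} G)$ be the set of orbits of $G$ under the action of $\operatorname{Inn}(\operatorname{Core} G)$. Then \[ |T|\leq|\operatorname{Good}(\operatorname{Core} G)|\leq |T|^{|\mathcal{O}|}. \]
   Context: A rack is a pair $R=(X,s)$ where $X$ is a nonempty set and $s:X\to S_X$, $x\mapsto s_x$, is a map to the symmetric group of $X$ with $s_xs_y=s_{s_x(y)}s_x$ for all $x,y\in X$. For a group $G$, the core quandle $\operatorname{Core} G=(G,s)$ is the rack with $s_g(h)=gh^{-1}g$. The inner automorphism group of $(X,s)$ is $\operatorname{Inn}(X,s)=\langle s_x\mid x\in X\rangle\leq S_X$. A good involution of $(X,s)$ is a map $\rho:X\to X$ with $\rho^2=\mathrm{id}_X$ (the identity is allowed) such that $\rho s_x=s_x\rho$ and $s_{\rho(x)}=s_x^{-1}$ for all $x\in X$; $\operatorname{Good} R$ denotes the set of good involutions of a rack $R$. Bars denote cardinality. *)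

(* Defs.v *)
From HB Require Import structures.
From mathcomp Require Import all_boot.
From mathcomp Require Import boolp classical_sets functions cardinality.

Set Implicit Arguments.
Unset Strict Implicit.
Unset Printing Implicit Defensive.

Local Open Scope classical_set_scope.
Local Open Scope group_scope.

(* The symmetric group of an arbitrary type.  The inverse is stored so that
   inversion computes; it is determined by the function (symP). *)
Record sym (X : Type) := Sym {
  sym_fun :> X -> X;
  sym_inv : X -> X;
  sym_funK : cancel sym_fun sym_inv;
  sym_invK : cancel sym_inv sym_fun
}.

Lemma symP (X : Type) (f g : sym X) : (f : X -> X) =1 g -> f = g.
Proof.
case: f g => [f f' fK f'K] [g g' gK g'K] /= fg.
have {}fg : f = g by apply/funext.
subst g.
have f'g' : f' = g' by apply/funext => x; rewrite -[x in LHS]g'K fK.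
subst g'.
by congr Sym; exact: Prop_irrelevance.
Qed.

Section SymGroup.
Variable X : Type.

Definition sym_one : sym X := @Sym X id id (fun=> erefl) (fun=> erefl).

Definition sym_mul (f g : sym X) : sym X :=
  Sym (can_comp (sym_funK f) (sym_funK g))
      (can_comp (sym_invK g) (sym_invK f)).

Definition sym_invg (f : sym X) : sym X := Sym (sym_invK f) (sym_funK f).

Lemma sym_mulA : associative sym_mul.
Proof. by move=> f g h; apply: symP. Qed.

Lemma sym_mul1g : left_id sym_one sym_mul.
Proof. by move=> f; apply: symP. Qed.

Lemma sym_mulg1 : right_id sym_one sym_mul.
Proof. by move=> f; apply: symP. Qed.

Lemma sym_mulVg : left_inverse sym_one sym_invg sym_mul.
Proof. by move=> f; apply: symP => x; exact: sym_funK. Qed.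

Lemma sym_mulgV : right_inverse sym_one sym_invg sym_mul.
Proof. by move=> f; apply: symP => x; exact: sym_invK. Qed.

HB.instance Definition _ := gen_eqMixin (sym X).
HB.instance Definition _ := gen_choiceMixin (sym X).
HB.instance Definition _ := isGroup.Build (sym X)
  sym_mulA sym_mul1g sym_mulg1 sym_mulVg sym_mulgV.

End SymGroup.

(* Products in [sym X] compose right to left, unlike those in [{perm T}]. *)
Lemma sym_mulE (X : Type) (f g : sym X) (x : X) : (f * g) x = f (g x).
Proof. by []. Qed.

Section Groups.
Variable G : groupType.

Definition subgroup (H : set G) : Prop :=
  [/\ H 1, forall x y, H x -> H y -> H (x * y) & forall x, H x -> H x^-1].

Definition generated (A : set G) : set G := smallest subgroup A.

Definition center : set G := [set z | forall g : G, commute z g].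

(* The exponent is the least m > 0 with x ^+ m = 1 for all x, and is infinite
   when there is no such m. *)
Definition exponent_gt (n : nat) : Prop :=
  forall m : nat, (0 < m <= n)%N -> ~ (forall x : G, x ^+ m = 1).

Lemma exponent_gt2P : exponent_gt 2 <-> exists g : G, g ^+ 2 <> 1.
Proof.
split=> [/(_ 2 isT)/existsNP//|[g g2] [|[|[|//]]] // _ G1]; last exact: g2.
by apply: g2; rewrite expgS !G1 mulg1; exact: (G1 g).
Qed.

End Groups.

Arguments center G : clear implicits.

Section Orbits.
Variable X : Type.

Definition orbit_of (H : set (sym X)) (x : X) : set X :=
  [set y | exists2 f, H f & f x = y].

Definition orbits (H : set (sym X)) : set (set X) := range (orbit_of H).

End Orbits.

Record rack := Rack {
  rack_sort :> Type;
  rack_s : rack_sort -> sym rack_sort;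
  rack_nonempty : [set: rack_sort] !=set0;
  rackP : forall x y : rack_sort,
    rack_s x * rack_s y = rack_s (rack_s x y) * rack_s x
}.

Definition Inn (R : rack) : set (sym R) := generated (range (@rack_s R)).

Definition Good (R : rack) : set (R -> R) :=
  [set rho : R -> R | [/\ rho \o rho = id,
                          forall x, rho \o rack_s x = rack_s x \o rho &
                          forall x, rack_s (rho x) = (rack_s x)^-1]].

Arguments Inn R : clear implicits.
Arguments Good R : clear implicits.

Section Core.
Variable G : groupType.

Definition core_fun (g h : G) : G := g * h^-1 * g.

Lemma core_funK (g : G) : cancel (core_fun g) (core_fun g).
Proof. by move=> h; rewrite /core_fun !invgM invgK !mulgA mulgV mul1g mulgVK. Qed.

Definition core_s (g : G) : sym G := Sym (core_funK g) (core_funK g).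

Lemma core_nonempty : [set: G] !=set0.
Proof. by exists 1. Qed.

Lemma core_rackP (g h : G) :
  core_s g * core_s h = core_s (core_s g h) * core_s g.
Proof.
apply: symP => k; rewrite !sym_mulE /= /core_fun.
by rewrite !invgM !invgK !mulgA mulgK mulgVK.
Qed.

Definition Core : rack := Rack core_nonempty core_rackP.

End Core.

(* Main.v *)
(** Since core symmetries are involutions, [rho] satisfies [s_(rho x) = s_x^-1]
    iff [s_(rho x) = s_x], that is, iff the displacement [x^-1 * rho x] lies in
    [T].  Commutation of [rho] with the symmetries then says that the
    displacement is constant on the orbits of the inner automorphism group.
    Hence a good involution is determined by a map from orbits to [T], and
    translations by elements of [T] are good involutions. *)
Require Import Defs.
From mathcomp Require Import all_boot.
From mathcomp Require Import boolp classical_sets functions cardinality.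

Local Open Scope classical_set_scope.
Local Open Scope card_scope.
Local Open Scope group_scope.

(** The image of [A] under [f] is equipotent to [A] and contained in [B]. *)
Lemma card_le_injective {aT rT : Type} {A : set aT} {B : set rT}
    (f : aT -> rT) :
  {homo f : x / A x >-> B x} -> {in A &, injective f} -> A #<= B.
Proof.
move=> fAB f_inj; rewrite -(card_le_eql (inj_card_eq f_inj)).
by apply: subset_card_le => _ [x Ax <-]; exact: fAB.
Qed.

Section CoreQuandle.
Variable G : groupType.

Definition center2 : set G := [set z | center G z /\ z ^+ 2 = 1].

Lemma center2_1 : center2 1.
Proof. by split=> [g|]; [exact/commute_sym/commute1 | exact: expg1n]. Qed.

Lemma center2_mulgg {z : G} : center2 z -> z * z = 1.
Proof. by case. Qed.

Lemma center2V {z : G} : center2 z -> z^-1 = z.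
Proof. by move=> /center2_mulgg zz; apply: (mulgI z); rewrite mulgV zz. Qed.

Lemma core_sV (x : G) : (core_s x)^-1 = core_s x.
Proof. exact: symP. Qed.

Lemma core_s_eqP (x y : G) : core_s x = core_s y <-> center2 (x^-1 * y).
Proof.
split=> [exy | Tz].
  (* Evaluation at [x * k^-1] gives [z * k * z = k] for [z = x^-1 * y]; the case [k = 1] yields
     [z * z = 1], and then [z] commutes with every [k]. *)
  have: forall k, x^-1 * y * k * (x^-1 * y) = k.
    move=> k; have := congr1 (fun f : sym G => f (x * k^-1)) exy.
    rewrite /= /core_fun !invgM !invgK !mulgA mulgVK => xk.
    by rewrite -[RHS](mulKg x) xk !mulgA.
  move: (x^-1 * y) => z zkz.
  have zz : z * z = 1 by rewrite -{1}[z]mulg1 zkz.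
  by split=> // k; rewrite /commute -[in RHS](zkz k) -!mulgA zz mulg1.
apply: symP => h /=; rewrite /core_fun -[y](mulVKg x).
move: (x^-1 * y) Tz => z Tz; have [zC _] := Tz.
by rewrite -(zC x) !mulgA -(zC (z * x * h^-1)) !mulgA center2_mulgg // mul1g.
Qed.

Lemma good_displacement {rho : G -> G} (x : G) :
  Good (Core G) rho -> center2 (x^-1 * rho x).
Proof. by case=> _ _ srho; apply/core_s_eqP; rewrite -core_sV -srho. Qed.

(** Writing [rho y = y * z] with [z] in [T], commutation gives [rho (s_x y) = s_x (y * z) = x * z^-1
    * y^-1 * x], and the central involutive [z] moves to the far right. *)
Lemma good_displacement_core {rho : G -> G} (x y : G) :
  Good (Core G) rho ->
  (core_fun x y)^-1 * rho (core_fun x y) = y^-1 * rho y.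
Proof.
move=> good; have [_ /(_ x)/(congr1 (@^~ y))/= -> _] := good.
have Tz := good_displacement y good.
rewrite /core_fun -{1}[rho y](mulVKg y).
move: (y^-1 * rho y) Tz => z Tz; have [zC _] := Tz.
rewrite (invgM y z) (center2V Tz) (zC y^-1) (mulgA x y^-1 z).
by rewrite -(mulgA _ z x) (zC x) (mulgA _ x z) mulKg.
Qed.

Lemma good_displacement_Inn {rho : G -> G} (f : sym G) (x : G) :
  Good (Core G) rho -> Inn (Core G) f -> (f x)^-1 * rho (f x) = x^-1 * rho x.
Proof.
move=> good; set d := fun x => x^-1 * rho x; rewrite -/(d (f x)) -/(d x).
(* The permutations preserving [d] form a subgroup containing every [s_x], hence all of [Inn]. *)
move=> Innf; suff: [set g : sym G | d \o g =1 d] f by apply.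
move: f Innf {x}; apply: smallest_sub => [|_ [x _ <-] y].
  split=> [//|f g df dg x|f df x]; first by rewrite -(dg x); exact: df.
  by rewrite -[in RHS](sym_invK f x); apply/esym/df.
exact: good_displacement_core.
Qed.

Lemma good_mulr_center2 (z : G) :
  center2 z -> Good (Core G) (fun x => x * z).
Proof.
move=> Tz; have [zC _] := Tz.
split=> [|x|x].
- by apply/funext => x /=; rewrite -mulgA center2_mulgg ?mulg1.
- apply/funext => y /=; rewrite /core_fun (invgM y z) (center2V Tz).
  by rewrite (zC y^-1) (mulgA x y^-1 z) -(mulgA _ z x) (zC x) mulgA.
- by rewrite /= core_sV; apply/esym/core_s_eqP; rewrite mulKg.
Qed.

(** The displacement is read at a chosen point of the orbit; the default value [1] of [insubd] makes
    this total in [rho], and is not reached when [rho] is good. *)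
Definition orbit_displacement (rho : G -> G) (o : orbits (Inn (Core G))) :
    center2 :=
  let x := xget 1 (val o) in insubd (SigSub (mem_set center2_1)) (x^-1 * rho x).

Lemma orbit_displacementE {rho : G -> G} (x : G)
    (Ox : orbit_of (Inn (Core G)) x \in orbits (Inn (Core G))) :
  Good (Core G) rho ->
  val (orbit_displacement rho (SigSub Ox)) = x^-1 * rho x.
Proof.
move=> good; rewrite val_insubd mem_set /=; last exact: good_displacement.
(* The orbit is inhabited, so the chosen point is some [f x] with [f] in [Inn]. *)
have: orbit_of (Inn (Core G)) x x.
  by exists 1 => //; move=> H [[]].
move=> /(xgetI 1)[f Innf <-].
exact: good_displacement_Inn.
Qed.

Lemma orbit_displacement_inj : {in Good (Core G) &, injective orbit_displacement}.
Proof.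
move=> rho sigma /set_mem grho /set_mem gsigma e; apply/funext => x.
have Ox : orbit_of (Inn (Core G)) x \in orbits (Inn (Core G)).
  by apply: mem_set; exists x.
apply: (mulgI x^-1).
by rewrite -(orbit_displacementE _ Ox grho) e orbit_displacementE.
Qed.

End CoreQuandle.

Theorem corollary7p14 (G : groupType) (hG : exponent_gt G 2) :
  let T : set G := [set z | center G z /\ z ^+ 2 = 1] in
  let O : set (set G) := orbits (Inn (Core G)) in
  T #<= Good (Core G) /\ Good (Core G) #<= [set: set_type O -> set_type T].
Proof.
move=> T O; split.
  apply: (card_le_injective (fun z x : G => x * z)) => [z Tz|z w _ _].
    exact: good_mulr_center2.
  (* A translation is determined by its value at [1]. *)
  by move=> /(congr1 (@^~ 1)); rewrite !mul1g.
exact: (card_le_injective (@orbit_displacement G) _ (@orbit_displacement_inj G)).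
Qed.
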